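(* Let $\Sigma$ be a set of equations in a finitary algebraic signature, and let $\mathcal{V}(\Sigma)$ be the variety of all algebras satisfying $\Sigma$. If $\mathcal{V}(\Sigma)$ is congruence modular, then the free-algebra functor $F_\Sigma:\mathrm{Set}\to\mathrm{Set}$ does not preserve preimages.
   Context: A variety is congruence modular if the congruence lattice of each of its algebras is modular. $\Sigma\vdash p\approx q$ means that the equation $p\approx q$ is a consequence of $\Sigma$. For a set $X$, considered as a set of variables, $F_\Sigma(X)$ is (the underlying set of) the free $\Sigma$-algebra over $X$: it consists of equivalence classes of terms with variables from $X$, where $p$ and $q$ are identified iff $\Sigma\vdash p\approx q$. For a map $\varphi:X\to Y$, $F_\Sigma\varphi$ is variable substitution $p(x_1,\dots,x_n)\mapsto p(\varphi x_1,\dots,\varphi x_n)$. Convention: Set-functors are assumed to preserve all monos, if necessary after modifying them only on the empty set $\emptyset$ and on the empty maps $\emptyset\to X$. A pullback of $f_1$ and $f_2$ is called a preimage if $f_1$ or $f_2$ is mono. A functor preserves preimages if it transforms every such pullback diagram into a pullback diagram; for functors preserving monos this is equivalent to weakly preserving preimages, i.e. transforming every such diagram into a weak pullback diagram.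
   Formalization: The case where the equations imply x ≈ y and the signature has a constant symbol is excluded: there the variety is trivial, hence congruence modular, and the free-algebra functor is constantly a one-element set, which preserves all preimages. *)

(* Defs.v *)
From HB Require Import structures.
From Stdlib Require Import RelationClasses.
From mathcomp Require Import all_boot all_order generic_quotient.
From mathcomp Require Import boolp classical_sets.

Set Implicit Arguments.
Unset Strict Implicit.
Unset Printing Implicit Defensive.

Local Open Scope classical_set_scope.
Local Open Scope quotient_scope.

Record signature := Signature { op : Type; arity : op -> nat }.

Inductive term (S : signature) (X : Type) : Type :=
| Var (x : X)
| App (o : op S) (args : 'I_(arity o) -> term S X).
Arguments Var {S X} x.
Arguments App {S X} o args.

Fixpoint subst (S : signature) (X Y : Type) (s : X -> term S Y)
    (t : term S X) : term S Y :=
  match t with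
  | Var x => s x
  | App o args => App o (fun i => subst s (args i))
  end.

(* Terms are finitary, so a countable set of variables suffices for axioms. *)
Definition equations (S : signature) := set (term S nat * term S nat).

(* Equational logic over the variables X.  An element of X is never assumed to
   exist, so on X = empty set only ground substitution instances are used; as
   soon as there is a ground term at all, these derive the same ground equations
   as a calculus with additional variables. *)
Inductive derives (S : signature) (Sigma : equations S) (X : Type) :
    term S X -> term S X -> Prop :=
| derives_ax p q (s : nat -> term S X) :
    Sigma (p, q) -> derives Sigma (subst s p) (subst s q)
| derives_refl t : derives Sigma t t
| derives_sym t u : derives Sigma t u -> derives Sigma u t
| derives_trans t u v :
    derives Sigma t u -> derives Sigma u v -> derives Sigma t v
| derives_app o (a b : 'I_(arity o) -> term S X) :
    (forall i, derives Sigma (a i) (b i)) ->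
    derives Sigma (App o a) (App o b).

Record algebra (S : signature) := Algebra {
  carrier :> Type;
  interp : forall o : op S, ('I_(arity o) -> carrier) -> carrier
}.
Arguments interp {S} a o args.

Fixpoint eval (S : signature) (A : algebra S) (X : Type) (e : X -> A)
    (t : term S X) : A :=
  match t with
  | Var x => e x
  | App o args => interp A o (fun i => eval e (args i))
  end.

Definition satisfies (S : signature) (A : algebra S) (X : Type)
    (p q : term S X) : Prop :=
  forall e : X -> A, eval e p = eval e q.

Definition variety (S : signature) (Sigma : equations S) (A : algebra S) : Prop :=
  forall p q, Sigma (p, q) -> satisfies A p q.

Definition congruence (S : signature) (A : algebra S) : set (set (A * A)) :=
  [set theta | Equivalence (fun x y => theta (x, y)) /\
     forall (o : op S) (a b : 'I_(arity o) -> A),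
       (forall i, theta (a i, b i)) -> theta (interp A o a, interp A o b)].

(* In the lattice of congruences of A, ordered by inclusion, the meet is the
   intersection and the join is the congruence generated by the union. *)
Definition cong_join (S : signature) (A : algebra S) (alpha beta : set (A * A)) :
    set (A * A) :=
  smallest (congruence (A := A)) (alpha `|` beta).

Definition modular_congruences (S : signature) (A : algebra S) : Prop :=
  forall alpha beta gamma : set (A * A),
    congruence alpha -> congruence beta -> congruence gamma ->
    alpha `<=` gamma ->
    cong_join alpha (beta `&` gamma) = cong_join alpha beta `&` gamma.

Definition congruence_modular (S : signature) (V : algebra S -> Prop) : Prop :=
  forall A : algebra S, V A -> modular_congruences A.

Section FreeAlgebraFunctor.
Variables (S : signature) (Sigma : equations S).

Definition derivesb (X : Type) : rel {classic term S X} :=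
  fun p q => `[< derives Sigma p q >].

Lemma derivesb_equiv (X : Type) : equiv_class_of (@derivesb X).
Proof.
split=> [p|p q|q p r].
- exact/asboolP/derives_refl.
- by apply/asboolP/asboolP => /derives_sym.
- by move=> /asboolP pq /asboolP qr; apply/asboolP/(derives_trans pq).
Qed.

Canonical derives_equiv (X : Type) := EquivRelPack (derivesb_equiv X).

Definition free (X : Type) : Type := {eq_quot (derives_equiv X)}.

Definition free_class (X : Type) (p : term S X) : free X :=
  \pi_({eq_quot (derives_equiv X)}) p.

Lemma free_classP (X : Type) (p q : term S X) :
  free_class p = free_class q <-> derives Sigma p q.
Proof. by split=> [/eqquotP/asboolP|pq]; last exact/eqquotP/asboolP. Qed.

Lemma free_class_repr (X : Type) (c : free X) : free_class (repr c) = c.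
Proof. exact: reprK. Qed.

Definition free_map (X Y : Type) (phi : X -> Y) (c : free X) : free Y :=
  free_class (subst (fun x => Var (phi x)) (repr c)).

End FreeAlgebraFunctor.

Arguments free_class {S} Sigma {X} p.
Arguments free_map {S} Sigma {X Y} phi c.

Lemma subst_comp (S : signature) (X Y Z : Type) (s : X -> term S Y)
    (r : Y -> term S Z) (t : term S X) :
  subst r (subst s t) = subst (fun x => subst r (s x)) t.
Proof. by elim: t => //= o a IH; congr App; apply/funext. Qed.

Lemma subst_Var (S : signature) (X : Type) (t : term S X) : subst Var t = t.
Proof. by elim: t => //= o a IH; congr App; apply/funext. Qed.

Lemma derives_subst (S : signature) (Sigma : equations S) (X Y : Type)
    (s : X -> term S Y) (p q : term S X) :
  derives Sigma p q -> derives Sigma (subst s p) (subst s q).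
Proof.
elim=> /= [p' q' r pq|t|t u _|t u v _ tu _|o a b _].
- by rewrite !subst_comp; apply: derives_ax.
- exact: derives_refl.
- exact: derives_sym.
- exact: derives_trans.
- exact: derives_app.
Qed.

Lemma free_map_class (S : signature) (Sigma : equations S) (X Y : Type)
    (phi : X -> Y) (p : term S X) :
  free_map Sigma phi (free_class Sigma p) =
  free_class Sigma (subst (fun x => Var (phi x)) p).
Proof.
apply/free_classP/derives_subst/(free_classP Sigma).
exact: free_class_repr.
Qed.

Lemma free_map_id (S : signature) (Sigma : equations S) (X : Type)
    (c : free Sigma X) :
  free_map Sigma id c = c.
Proof. by rewrite -[c]free_class_repr free_map_class subst_Var. Qed.

Lemma free_map_comp (S : signature) (Sigma : equations S) (X Y Z : Type)
    (phi : X -> Y) (psi : Y -> Z) (c : free Sigma X) :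
  free_map Sigma (psi \o phi) c = free_map Sigma psi (free_map Sigma phi c).
Proof.
by rewrite -[c]free_class_repr !free_map_class subst_comp.
Qed.

Lemma eval_subst (S : signature) (A : algebra S) (X Y : Type)
    (s : X -> term S Y) (e : Y -> A) (t : term S X) :
  eval e (subst s t) = eval (fun x => eval e (s x)) t.
Proof. by elim: t => //= o a IH; congr interp; apply/funext. Qed.

Definition free_algebra (S : signature) (Sigma : equations S) (X : Type) :
    algebra S :=
  Algebra (fun o (args : 'I_(arity o) -> free Sigma X) =>
    free_class Sigma (App o (fun i => repr (args i)))).

Lemma eval_free (S : signature) (Sigma : equations S) (X Y : Type)
    (s : X -> term S Y) (t : term S X) :
  eval (A := free_algebra Sigma Y) (fun x => free_class Sigma (s x)) t =
  free_class Sigma (subst s t).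
Proof.
elim: t => //= o a IH; apply/free_classP/derives_app => i.
by apply/(free_classP Sigma); rewrite free_class_repr IH.
Qed.

Lemma free_algebra_variety (S : signature) (Sigma : equations S) (X : Type) :
  variety Sigma (free_algebra Sigma X).
Proof.
move=> p q pq e.
have -> : e = (fun x => free_class Sigma (repr (e x))).
  by apply/funext => x; rewrite free_class_repr.
by rewrite !eval_free; apply/free_classP/derives_ax.
Qed.

(* Derivability is semantic consequence. *)
Lemma derivesP (S : signature) (Sigma : equations S) (X : Type)
    (p q : term S X) :
  derives Sigma p q <->
  forall A : algebra S, variety Sigma A -> satisfies A p q.
Proof.
split=> [pq A VA e|/(_ _ (@free_algebra_variety S Sigma X))].
  elim: pq => //= [p' q' s pq|t u v _ -> _ ->//|o a b _ IH].
    by rewrite !eval_subst; apply: VA.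
  by congr interp; apply/funext.
by move=> /(_ (fun x => free_class Sigma (Var x)));
   rewrite !eval_free !subst_Var => /free_classP.
Qed.

(* Every injection is preserved, including those from the empty set, so the
   functor need not be modified there: on the empty set it consists of the
   classes of ground terms. *)
Lemma free_map_inj (S : signature) (Sigma : equations S) (X Y : Type)
    (phi : X -> Y) :
  injective phi -> injective (free_map Sigma phi).
Proof.
move=> phi_inj c d; rewrite -[c]free_class_repr -[d]free_class_repr.
set p := repr c; set q := repr d; rewrite !free_map_class.
move=> /free_classP pq; apply/free_classP.
pose r y : term S X :=
  if pselect (exists x, phi x = y) is left h then Var (projT1 (cid h)) else p.
have rphi : (fun x => r (phi x)) = Var.
  apply/funext => x; rewrite /r; case: pselect => [h|[]]; last by exists x.
  by congr Var; apply: phi_inj; case: cid.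
by have := derives_subst r pq; rewrite !subst_comp /= rphi !subst_Var.
Qed.

(* The sets and maps P --p1--> X1 --f1--> Y <--f2-- X2 <--p2-- P form a pullback
   square in Set. *)
Definition is_pullback (P X1 X2 Y : Type) (p1 : P -> X1) (p2 : P -> X2)
    (f1 : X1 -> Y) (f2 : X2 -> Y) : Prop :=
  f1 \o p1 = f2 \o p2 /\
  forall (Q : Type) (q1 : Q -> X1) (q2 : Q -> X2), f1 \o q1 = f2 \o q2 ->
    exists! h : Q -> P, p1 \o h = q1 /\ p2 \o h = q2.

Definition preserves_preimages (F : Type -> Type)
    (Fmap : forall X Y : Type, (X -> Y) -> F X -> F Y) : Prop :=
  forall (P X1 X2 Y : Type) (p1 : P -> X1) (p2 : P -> X2)
      (f1 : X1 -> Y) (f2 : X2 -> Y),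
    injective f1 \/ injective f2 ->
    is_pullback p1 p2 f1 f2 ->
    is_pullback (Fmap _ _ p1) (Fmap _ _ p2) (Fmap _ _ f1) (Fmap _ _ f2).

Definition trivial_equations (S : signature) (Sigma : equations S) : Prop :=
  derives Sigma (Var 0) (Var 1).

Definition has_constant (S : signature) : Prop :=
  exists c : op S, arity c = 0.

(* A trivial variety with a constant is congruence modular, while its free
   algebra functor is constantly a one-element set and thus preserves all
   pullbacks.  This degenerate case has to be excluded from any negative result
   about congruence modular varieties. *)
Lemma trivial_pointed (S : signature) (Sigma : equations S) :
  trivial_equations Sigma -> has_constant S ->
  congruence_modular (variety Sigma) /\
  preserves_preimages (@free_map S Sigma).
Proof.
move=> triv [c c0]; split=> [A VA|].
  have all_eq (x y : A) : x = y.
    exact: (proj1 (derivesP _ _ _) triv A VA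
      (fun n => if n is 0 then x else y)).
  have allP theta : congruence (A := A) theta -> theta = setT.
    move=> [[r _ _] _]; apply/seteqP; split=> // -[x y] _.
    by rewrite (all_eq x y); apply: r.
  move=> alpha beta gamma /allP -> /allP -> /allP -> _.
  by rewrite /cong_join !setIT.
have all_eq X (d e : free Sigma X) : d = e.
  rewrite -[d]free_class_repr -[e]free_class_repr; apply/free_classP.
  exact: (derives_subst (fun n => if n is 0 then repr d else repr e) triv).
have inh X : free Sigma X.
  by apply/(free_class Sigma)/(App c) => -[i]; rewrite c0.
move=> P X1 X2 Y p1 p2 f1 f2 _ _; split; first by apply/funext => x.
move=> Q q1 q2 _; exists (fun=> inh P); split.
  by split; apply/funext => x.
by move=> h _; apply/funext => x.
Qed.

(* Main.v *)
Require Import Defs.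
From mathcomp Require Import all_boot.
From mathcomp Require Import boolp classical_sets.

Set Implicit Arguments.
Unset Strict Implicit.
Unset Printing Implicit Defensive.

Local Open Scope classical_set_scope.

(** Take the free algebra on [x = (false, false)], [u = (false, true)],
    [y = (true, false)], [z = (true, true)], and the kernels [gamma], [beta],
    [alpha] of the maps induced by [fst], by [snd], and by the map identifying
    just [y] and [z].  Then [x beta y alpha z beta u] and [x gamma u], so
    modularity puts [(x, u)] in the join of [alpha] and [beta /\ gamma].
    Preservation of the preimage of [{false}] under [fst] says that the
    [gamma]-class of [x] consists of elements of [F {x, u}], on which the maps
    defining [alpha] and [beta] are injective.  Hence [{x}] is a class of both
    [alpha] and [beta /\ gamma], so also of their join, and [x = u]: the
    equations are trivial.  A trivial variety without constants has
    [F] of the empty set empty and [F] of any other set a point, so the empty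
    preimage of one point of [bool] under the inclusion of the other is not
    preserved. *)

(** Cones with apex [unit] are pairs of elements; conversely, choice glues the pointwise solutions
    into the mediating map. *)
Lemma is_pullbackP (P X1 X2 Y : Type) (p1 : P -> X1) (p2 : P -> X2)
    (f1 : X1 -> Y) (f2 : X2 -> Y) :
  is_pullback p1 p2 f1 f2 <->
  (forall c, f1 (p1 c) = f2 (p2 c)) /\
  (forall a b, f1 a = f2 b -> exists! c, p1 c = a /\ p2 c = b).
Proof.
split=> -[fp univ]; split.
- by move=> c; have /(congr1 (@^~ c)) := fp.
- move=> a b fab; have [|h [[h1 h2] huniq]] :=
    univ unit (fun=> a) (fun=> b); first exact/funext.
  exists (h tt); split.
    by split; [have /(congr1 (@^~ tt)) := h1 | have /(congr1 (@^~ tt)) := h2].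
  move=> c [c1 c2]; rewrite (huniq (fun=> c)) //.
  by split; apply/funext.
- exact/funext.
- move=> Q q1 q2 fq.
  have fqE x : f1 (q1 x) = f2 (q2 x) by have /(congr1 (@^~ x)) := fq.
  have [h hP] := choice (fun x => univ _ _ (fqE x)).
  exists h; split.
    by split; apply/funext => x; have [[]] := hP x.
  move=> k [k1 k2]; apply/funext => x; have [_] := hP x; apply.
  by split; [have /(congr1 (@^~ x)) := k1 | have /(congr1 (@^~ x)) := k2].
Qed.

(** Descending through first arguments can only stop at a nullary operation. *)
Lemma ground_term_has_constant (S : signature) :
  term S False -> has_constant S.
Proof.
elim=> [[]|o args IH].
case E: (arity o) => [|n]; first by exists o.
by apply: IH; rewrite E; apply: ord0.
Qed.

Section Congruences.
Variables (S : signature) (A : algebra S).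

Inductive translation : (A -> A) -> Prop :=
| translation_id : translation id
| translation_op f o (i : 'I_(arity o)) (a : 'I_(arity o) -> A) :
    translation f ->
    translation (fun s => f (interp A o (fun j => if j == i then s else a j))).

Lemma congruence_translation (theta : set (A * A)) f s t :
  congruence theta -> translation f -> theta (s, t) -> theta (f s, f t).
Proof.
move=> [[r _ _] c] tf; elim: tf s t => //= g o i a _ IH s t st.
by apply/IH/c => j; case: eqP => // _; apply: r.
Qed.

(** As for formal languages, this is the largest congruence for which [B] is a union of classes. *)
Definition syntactic (B : set A) : set (A * A) :=
  [set p | forall f, translation f -> B (f p.1) <-> B (f p.2)].

Lemma syntactic_congruence (B : set A) : congruence (syntactic B).
Proof.
split; first split.
- by move=> s f _; apply: iff_refl.
- by move=> s t st f tf; apply: iff_sym; apply: st.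
- by move=> s t v st tv f tf; apply: (iff_trans (st f tf)); apply: tv.
move=> o a b ab f tf /=.
(* Arguments are exchanged one at a time: [h k] has the first [k] from [b], and passing to [h k.+1]
   is a single translation. *)
pose h k (j : 'I_(arity o)) := if j < k then b j else a j.
have hP k : k <= arity o ->
    B (f (interp A o a)) <-> B (f (interp A o (h k))).
  elim: k => [_|k IH kn]; first exact: iff_refl.
  apply: (iff_trans (IH (ltnW kn))); pose i := Ordinal kn.
  have := ab i _ (translation_op i (h k) tf); rewrite /=.
  have -> : (fun j => if j == i then a i else h k j) = h k.
    by apply/funext => j; case: eqP => // ->; rewrite /h ltnn.
  have -> // : (fun j => if j == i then b i else h k j) = h k.+1.
  apply/funext => j; rewrite /h ltnS.
  case: (eqVneq j i) => [->|]; first by rewrite leqnn.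
  by rewrite [in RHS]leq_eqVlt -val_eqE /= => /negPf ->.
have -> // : b = h (arity o); last exact: hP.
by apply/funext => j; rewrite /h ltn_ord.
Qed.

(* [syntactic [set x]] is the largest congruence with [{x}] as a class, which
   makes an explicit description of the join by chains unnecessary. *)
Lemma cong_join_class1 (alpha beta : set (A * A)) (x y : A) :
  congruence alpha -> congruence beta ->
  (forall t, alpha (x, t) -> t = x) -> (forall t, beta (x, t) -> t = x) ->
  cong_join alpha beta (x, y) -> y = x.
Proof.
move=> ca cb ax bx xy; suff: syntactic [set x] (x, y).
  by move=> /(_ _ translation_id)[+ _]; apply.
apply: xy; split; first exact: syntactic_congruence.
suff sub theta : congruence theta -> (forall t, theta (x, t) -> t = x) ->
    theta `<=` syntactic [set x].
  by rewrite subUset; split; apply: sub.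
move=> ct tx [s t] st f tf /=.
have ft := congruence_translation ct tf st.
have [[_ sym _] _] := ct.
(* If one of [f s], [f t] is [x], then [theta] relates [x] to the other, so [tx] applies. *)
split=> fx; apply: tx; rewrite -fx //.
exact: sym.
Qed.

Lemma congruenceI (alpha beta : set (A * A)) :
  congruence alpha -> congruence beta -> congruence (alpha `&` beta).
Proof.
move=> [[ra sa ta] ca] [[rb sb tb] cb]; split; first split.
- by move=> s; split; [apply: ra | apply: rb].
- by move=> s t [? ?]; split; [apply: sa | apply: sb].
- by move=> s t v [? ?] [? ?]; split; [apply: (ta _ t) | apply: (tb _ t)].
- by move=> o a b ab; split; [apply: ca | apply: cb] => i; case: (ab i).
Qed.

End Congruences.

Section FreeKernel.
Variables (S : signature) (Sigma : equations S).

Definition free_kernel (X Y : Type) (phi : X -> Y) :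
    set (free_algebra Sigma X * free_algebra Sigma X) :=
  [set p | free_map Sigma phi p.1 = free_map Sigma phi p.2].

Lemma free_map_interp (X Y : Type) (phi : X -> Y) (o : op S)
    (a : 'I_(arity o) -> free Sigma X) :
  free_map Sigma phi (interp (free_algebra Sigma X) o a) =
  interp (free_algebra Sigma Y) o (fun i => free_map Sigma phi (a i)).
Proof.
rewrite /= free_map_class; apply/free_classP/derives_app => i.
by apply/(free_classP Sigma); rewrite free_class_repr.
Qed.

Lemma free_kernel_congruence (X Y : Type) (phi : X -> Y) :
  congruence (free_kernel phi).
Proof.
split; first split.
- by [].
- by move=> s t; rewrite /free_kernel /= => ->.
- by move=> s t v; rewrite /free_kernel /= => -> ->.
move=> o a b /funext ab.
transitivity (interp (free_algebra Sigma Y) o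
  (fun i => free_map Sigma phi (a i))); first exact: free_map_interp.
by rewrite ab; apply: esym; apply: free_map_interp.
Qed.

Lemma free_kernel_comp (X Y Z : Type) (phi : X -> Y) (psi : Y -> Z) :
  free_kernel phi `<=` free_kernel (psi \o phi).
Proof.
move=> [s t]; rewrite /free_kernel /= => st.
by rewrite (free_map_comp phi psi s) (free_map_comp phi psi t) st.
Qed.

Lemma free_kernel_Var (X Y : Type) (phi : X -> Y) (x x' : X) :
  phi x = phi x' ->
  free_kernel phi (free_class Sigma (Var x), free_class Sigma (Var x')).
Proof. by move=> e; rewrite /free_kernel /= !free_map_class /= e. Qed.

Lemma trivial_modular_preimages :
  congruence_modular (variety Sigma) ->
  preserves_preimages (@free_map S Sigma) ->
  trivial_equations Sigma.
Proof.
move=> cm pp.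
pose A := free_algebra Sigma (bool * bool).
pose v (p : bool * bool) : A := free_class Sigma (Var p).
(* [c] erases the second bit only where the first is true, so [fst \o c] and [c \o inc] compute to
   [fst] and [inc]. *)
pose c (p : bool * bool) := (p.1, ~~ p.1 && p.2).
pose alpha := free_kernel c; pose beta := free_kernel (@snd bool bool).
pose gamma := free_kernel (@fst bool bool).
pose inc (b : bool) := (false, b).
have ag : alpha `<=` gamma := @free_kernel_comp _ _ _ c fst.
have gammaP t : gamma (v (false, false), t) ->
    exists s, free_map Sigma inc s = t.
  have /is_pullbackP[_ univ] : is_pullback (free_map Sigma inc)
    (free_map Sigma (fun=> tt)) (free_map Sigma (@fst bool bool))
    (free_map Sigma (fun=> false)).
    apply: pp; first by right=> -[] [].
    apply/is_pullbackP; split=> // -[a b] [] /= ->; exists b; split=> //.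
    by move=> b' [[->]].
  rewrite /gamma /free_kernel /= free_map_class /= => e.
  have [|s [[<- _] _]] := univ t (free_class Sigma (Var tt)); last by exists s.
  by rewrite -e free_map_class.
have alpha1 t : alpha (v (false, false), t) -> t = v (false, false).
  move=> xt; have [s st] := gammaP _ (ag _ xt); move: xt.
  rewrite /alpha /free_kernel /= free_map_class -st -free_map_comp /=.
  exact: esym.
have bg1 t : (beta `&` gamma) (v (false, false), t) -> t = v (false, false).
  move=> [xt /gammaP[s st]]; move: xt.
  (* Here [snd \o inc] is the identity, so [s] itself is the class of a variable. *)
  rewrite /beta /free_kernel /= free_map_class -st -free_map_comp /=.
  by rewrite (free_map_id s) => <-; rewrite free_map_class.
have xu : v (false, true) = v (false, false).
  apply: (cong_join_class1 _ _ alpha1 bg1); first exact: free_kernel_congruence.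
    by apply: congruenceI; exact: free_kernel_congruence.
  rewrite (cm A (@free_algebra_variety _ _ _)) //;
    try exact: free_kernel_congruence.
  split; last exact: free_kernel_Var.
  move=> theta [[[_ _ tr] _]]; rewrite subUset => -[at_ bt].
  apply: (tr _ (v (true, false))); first exact/bt/free_kernel_Var.
  apply: (tr _ (v (true, true))); first exact/at_/free_kernel_Var.
  exact/bt/free_kernel_Var.
have /derives_sym d := (free_classP Sigma _ _).1 xu.
(* The second bit sends x to [Var 0] and u to [Var 1]. *)
exact: (derives_subst (fun p : bool * bool => Var (nat_of_bool p.2)) d).
Qed.

Lemma trivial_preimages_has_constant :
  trivial_equations Sigma -> preserves_preimages (@free_map S Sigma) ->
  has_constant S.
Proof.
move=> triv pp.
have /is_pullbackP[_ univ] : is_pullback (free_map Sigma (False_rect unit))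
    (free_map Sigma (False_rect unit)) (free_map Sigma (fun=> false))
    (free_map Sigma (fun=> true)).
  apply: pp; first by left=> -[] [].
  by apply/is_pullbackP; split=> // -[].
pose one := free_class Sigma (Var tt).
(* Triviality identifies the images of [one] under both inclusions, so the pair lifts to some [s]
   over [False], represented by a ground term. *)
have [|s _] := univ one one.
  rewrite !free_map_class; apply/free_classP.
  exact: (derives_subst (fun n => Var (n != 0)) triv).
exact: ground_term_has_constant (repr s).
Qed.

End FreeKernel.

Theorem mainTheorem5 (S : signature) (Sigma : equations S)
    (nondegenerate : ~ (trivial_equations Sigma /\ has_constant S)) :
  congruence_modular (variety Sigma) ->
  ~ preserves_preimages (@free_map S Sigma).
Proof.
move=> cm pp; apply: nondegenerate.
have triv := trivial_modular_preimages cm pp.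
by split=> //; exact: trivial_preimages_has_constant triv pp.
Qed.
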